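(* For any $\mu = (\mu_1, \dots, \mu_r) \in (\mathbb{Z}_{\geq 0})^r$ with $\mu_1 > \mu_2 > \dots > \mu_r$, any $N \in \mathbb{Z}_{\geq 0}$ such that $Nm \geq \mu_1$, and any $\sigma = (\sigma_1, \dots, \sigma_r) \in \mathcal{P}^r$ we have that \begin{equation*} Z^{\mathrm{R}}_{\mu,\sigma}(\mathbf{z}) = \mathbf{z}^N Z^{\mathrm{L},N}_{\mu,w_0\sigma}(w_0\mathbf{z}), \end{equation*} where $w_0$ is the longest element of the symmetric group $S_r$, i.e.\ the order reversing permutation.
   Context: Fix a palette $\mathcal{P}=\{c_1<\dots<c_m\}$ of $m$ colors and parameters $q$, $\Phi$, $\mathfrak{X}_{i,j}$ ($1\le i,j\le r$) with $\mathfrak{X}_{i,i}=-q^2$ and $\mathfrak{X}_{i,j}\mathfrak{X}_{j,i}=q^2$ for $i\neq j$; row $i$ (rows numbered $1,\dots,r$ from top to bottom) carries the row parameter $z_i$, and $\mathbf{z}=(z_1,\dots,z_r)$. The (unfused) lattice is a grid with $r$ rows and $Nm$ columns, split into $N$ blocks of $m$ consecutive columns; within each block the columns have column colors $c_1,\dots,c_m$ from left to right, and columns are numbered $0,1,2,\dots$ from right to left. Each edge carries at most one colored path, and a vertical edge may only carry a path of its column color. A state is a labeling of all edges; its Boltzmann weight is the product of the weights of its vertices, and the partition function of a system is the sum of the weights of its states. Right-moving vertices (paths travel down and right), for column color $c_j$ and path color $c_i$: all edges empty: $1$; vertical path through and horizontal path of color $c_i$ through: $\Phi\mathfrak{X}_{i,j}\cdot(z$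 if $i=j$, else $1)$; only vertical path through: $\Phi$; only horizontal path of color $c_i$ through: $z$ if $i=j$, else $1$; path entering from the left and exiting at the bottom: $\Phi(1-q^2)z$; path entering from the top and exiting at the right: $1$. Left-moving vertices (paths travel down and left): all empty: $1$; vertical path through and horizontal path of color $c_i$ through: $\Phi\mathfrak{X}_{j,i}\cdot(z^{-1}$ if $i=j$, else $1)$; only vertical path through: $\Phi$; only horizontal path of color $c_i$ through: $z^{-1}$ if $i=j$, else $1$; path entering from the right and exiting at the bottom: $\Phi(1-q^2)$; path entering from the top and exiting at the left: $z^{-1}$. All other configurations have weight $0$. Here $z=z_i$ for a vertex on row $i$. Boundary conditions given by $\mu$ and $\sigma$: the top boundary edges at columns $\mu_1,\dots,\mu_r$ carry a path (of that column's color) and the other top edges are empty; the bottom boundary is empty. For the right-moving system the left boundary is empty and the right boundary edge of row $i$ carries color $\sigma_i$; for the left-moving system the right boundary is empty and the left boundary edge of row $i$ carries color $\sigma_i$. $Z^{\mathrm{R}}_{\mu,\sigma}(\mathbf{z})$ is the partition function of the right-moving system with these boundary conditions (it is independent of $N$ as long as $Nm\ge\mu_1$), and $Z^{\mathrm{L},N}_{\mu,\sigma}(\mathbf{z})$ is the partition function of the left-moving system with these boundary conditions on the grid with $Nm$ columns. Also $\mathbf{z}^N=(z_1z_2\cdots z_r)^N$, $w_0\mathbf{z}=(z_r,\dots,z_1)$ and $w_0\sigma=(\sigma_r,\dots,\sigma_1)$. *)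

(* Defs.v *)
From HB Require Import structures.
From mathcomp Require Import all_boot all_order all_algebra.

Set Implicit Arguments.
Unset Strict Implicit.
Unset Printing Implicit Defensive.

Import GRing.Theory.

Local Open Scope ring_scope.

(* Colors c_1 < ... < c_m are the elements of 'I_m (c_i is the ordinal i - 1),
   and rows 1, ..., r from top to bottom are the elements of 'I_r.
   The label of a horizontal edge is None (empty) or Some c (path of color c).
   A vertical edge may only carry a path of its column color, so its label is
   a boolean telling whether it carries such a path. *)

(* Boltzmann weights of a vertex in a column of color j and a row with
   parameter z, with labels t (top), l (left), b (bottom) and rt (right). *)

Definition weightR (F : fieldType) (m : nat) (q Phi : F) (X : 'I_m -> 'I_m -> F)
    (j : 'I_m) (z : F) (t : bool) (l : option 'I_m) (b : bool)
    (rt : option 'I_m) : F :=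
  match t, l, b, rt with
  | false, None, false, None => 1
  | true, Some i, true, Some i' =>
      if i == i' then Phi * X i j * (if i == j then z else 1) else 0
  | true, None, true, None => Phi
  | false, Some i, false, Some i' =>
      if i == i' then (if i == j then z else 1) else 0
  | false, Some i, true, None =>
      if i == j then Phi * (1 - q ^+ 2) * z else 0
  | true, None, false, Some i => if i == j then 1 else 0
  | _, _, _, _ => 0
  end.

Definition weightL (F : fieldType) (m : nat) (q Phi : F) (X : 'I_m -> 'I_m -> F)
    (j : 'I_m) (z : F) (t : bool) (l : option 'I_m) (b : bool)
    (rt : option 'I_m) : F :=
  match t, l, b, rt with
  | false, None, false, None => 1
  | true, Some i', true, Some i =>
      if i == i' then Phi * X j i * (if i == j then z^-1 else 1) else 0
  | true, None, true, None => Phi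
  | false, Some i', false, Some i =>
      if i == i' then (if i == j then z^-1 else 1) else 0
  | false, None, true, Some i =>
      if i == j then Phi * (1 - q ^+ 2) else 0
  | true, Some i, false, None => if i == j then z^-1 else 0
  | _, _, _, _ => 0
  end.

(* Labelings of the edges of a grid with r rows and n columns, the columns
   being numbered 0, ..., n - 1 from right to left.
   - s.1 i k is the vertical edge of column k above row i (below the last row
     if i = r), so the vertex (i, k) has top edge i and bottom edge i + 1;
   - s.2 i k is the horizontal edge of row i to the right of column k (the left
     boundary edge if k = n), so the vertex (i, k) has right edge k and left
     edge k + 1. *)
Definition labeling (m r n : nat) : finType :=
  ('M[bool]_(r.+1, n) * 'M[option 'I_m]_(r, n.+1))%type.

Definition has_boundary (m r n : nat) (top bottom : 'I_n -> bool)
    (left right : 'I_r -> option 'I_m) (s : labeling m r n) : bool :=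
  [&& [forall k, s.1 ord0 k == top k],
      [forall k, s.1 ord_max k == bottom k],
      [forall i, s.2 i ord_max == left i]
    & [forall i, s.2 i ord0 == right i]].

Definition state_weight (F : fieldType) (m r n : nat)
    (wt : 'I_m -> F -> bool -> option 'I_m -> bool -> option 'I_m -> F)
    (col : 'I_n -> 'I_m) (z : 'I_r -> F) (s : labeling m r n) : F :=
  \prod_(i < r) \prod_(k < n)
    wt (col k) (z i)
       (s.1 (widen_ord (leqnSn r) i) k) (s.2 i (lift ord0 k))
       (s.1 (lift ord0 i) k) (s.2 i (widen_ord (leqnSn n) k)).

Definition partition_function (F : fieldType) (m r n : nat)
    (wt : 'I_m -> F -> bool -> option 'I_m -> bool -> option 'I_m -> F)
    (col : 'I_n -> 'I_m) (top bottom : 'I_n -> bool)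
    (left right : 'I_r -> option 'I_m) (z : 'I_r -> F) : F :=
  \sum_(s : labeling m r n | has_boundary top bottom left right s)
    state_weight wt col z s.

Lemma block_size_gt0 (N m : nat) (k : 'I_(N * m)) : (0 < m)%N.
Proof. by case: m k => [|//]; rewrite muln0 => -[]. Qed.

(* Colors increase from left to right within a block whereas columns are
   numbered from right to left, hence the rev_ord. *)
Definition column_color (N m : nat) (k : 'I_(N * m)) : 'I_m :=
  rev_ord (Ordinal (ltn_pmod k (block_size_gt0 k))).

Definition top_boundary (r n : nat) (mu : 'I_r -> nat) (k : 'I_n) : bool :=
  [exists i, mu i == k].

(* Right-moving partition function on the grid with N blocks of columns; by
   ZR_blocks below it does not depend on N as long as the grid contains all the
   columns mu_1, ..., mu_r. *)
Definition ZR (F : fieldType) (m r : nat) (q Phi : F) (X : 'I_m -> 'I_m -> F)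
    (N : nat) (mu : 'I_r -> nat) (sigma : 'I_r -> 'I_m) (z : 'I_r -> F) : F :=
  partition_function (weightR q Phi X) (@column_color N m)
    (top_boundary mu) (fun=> false) (fun=> None) (fun i => Some (sigma i)) z.

Definition ZL (F : fieldType) (m r : nat) (q Phi : F) (X : 'I_m -> 'I_m -> F)
    (N : nat) (mu : 'I_r -> nat) (sigma : 'I_r -> 'I_m) (z : 'I_r -> F) : F :=
  partition_function (weightL q Phi X) (@column_color N m)
    (top_boundary mu) (fun=> false) (fun i => Some (sigma i)) (fun=> None) z.

(* Composition with rev_ord is the action of w_0. *)
Definition w0 (r : nat) (T : Type) (v : 'I_r -> T) : 'I_r -> T :=
  fun i => v (rev_ord i).

Definition shrink (m r n : nat) (s : labeling m r n.+1) : labeling m r n :=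
  (\matrix_(i, k) s.1 i (widen_ord (leqnSn n) k),
   \matrix_(i, k) s.2 i (widen_ord (leqnSn n.+1) k)).

Definition extend (m r n : nat) (s : labeling m r n) : labeling m r n.+1 :=
  (\matrix_(i, k) if unlift ord_max k is Some k' then s.1 i k' else false,
   \matrix_(i, k) if unlift ord_max k is Some k' then s.2 i k' else None).

Lemma widen_lift_max n (k : 'I_n) : widen_ord (leqnSn n) k = lift ord_max k.
Proof. by apply/val_inj; rewrite /= /bump leqNgt ltn_ord. Qed.

Lemma shrinkK_extend m r n : cancel (@extend m r n) (@shrink m r n).
Proof.
by case=> V H; congr (_, _); apply/matrixP => i k;
   rewrite !mxE widen_lift_max liftK.
Qed.

Lemma lift0_max n : lift ord0 (@ord_max n) = @ord_max n.+1.
Proof. by apply/val_inj. Qed.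

Lemma lift0_widen n (k : 'I_n) :
  lift ord0 (widen_ord (leqnSn n) k) = lift ord_max (lift ord0 k).
Proof. by apply/val_inj; rewrite /= /bump /= !add1n ltnS leqNgt ltn_ord. Qed.

(* An empty column on the left does not contribute to a right-moving system. *)
Lemma ZR_column (F : fieldType) (m r n : nat) (q Phi : F)
    (X : 'I_m -> 'I_m -> F) (col : nat -> 'I_m) (mu : 'I_r -> nat)
    (sigma : 'I_r -> 'I_m) (z : 'I_r -> F) (hn : forall i, (mu i < n)%N) :
  partition_function (weightR q Phi X) (fun k : 'I_n.+1 => col k)
    (top_boundary mu) (fun=> false) (fun=> None) (fun i => Some (sigma i)) z =
  partition_function (weightR q Phi X) (fun k : 'I_n => col k)
    (top_boundary mu) (fun=> false) (fun=> None) (fun i => Some (sigma i)) z.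
Proof.
pose emp (s : labeling m r n.+1) :=
  [forall i, ~~ s.1 i ord_max] &&
  [forall i, s.2 i (widen_ord (leqnSn n.+1) ord_max) == None].
rewrite /partition_function (bigID emp) /= [X in _ + X]big1 ?addr0; last first.
  move=> s /andP[/and4P[/forallP ht _ /forallP hl _]] /negP hE.
  apply/eqP/negPn/negP => nz; apply: hE.
  have nzi (i : 'I_r) : ~~ s.1 (widen_ord (leqnSn r) i) ord_max ->
      ~~ s.1 (lift ord0 i) ord_max /\
      s.2 i (widen_ord (leqnSn n.+1) ord_max) = None.
    move=> hti; move: nz; rewrite /state_weight => /prodf_neq0/(_ i isT).
    move=> /prodf_neq0/(_ ord_max isT); rewrite (negPf hti) lift0_max.
    rewrite (eqP (hl i)) /weightR.
    by case: (s.1 _ _); case: (s.2 _ _) => //=; rewrite ?eqxx.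
  have tE (i : 'I_r.+1) : ~~ s.1 i ord_max.
    case: i => i; elim: i => [|i IH] hi.
      have -> : Ordinal hi = ord0 by apply/val_inj.
      rewrite (eqP (ht _)) /top_boundary; apply/existsP => -[j] /eqP /= e.
      by have := hn j; rewrite e ltnn.
    have [] := nzi (Ordinal (hi : (i < r)%N)).
      have -> : widen_ord (leqnSn r) (Ordinal (hi : (i < r)%N))
              = Ordinal (ltnW hi) by apply/val_inj.
      exact: IH.
    by have -> : lift ord0 (Ordinal (hi : (i < r)%N)) = Ordinal hi
      by apply/val_inj.
  by apply/andP; split; apply/forallP => i //; have [_ ->] := nzi i (tE _).
rewrite (reindex_onto (@extend m r n) (@shrink m r n)) /=; last first.
  case=> V H /andP[/and4P[_ _ /forallP hl _] /andP[/forallP hv /forallP hh]].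
  congr (_, _); apply/matrixP => i k; rewrite !mxE.
    case: unliftP => [k' ->|->]; first by rewrite !mxE widen_lift_max.
    by have /negPf -> := hv i.
  case: unliftP => [k' ->|->]; first by rewrite !mxE widen_lift_max.
  by have /eqP -> := hl i.
apply: eq_big => [s|s /andP[/andP[_ /andP[_ /forallP he]] _]].
  rewrite shrinkK_extend eqxx andbT.
  apply/andP/and4P => [[/and4P[h1 h2 h3 h4] /andP[h5 h6]]|[h1 h2 h3 h4]].
    split; apply/forallP => i.
    - have := forallP h1 (lift ord_max i); rewrite mxE liftK => /eqP ->.
      by rewrite /top_boundary -widen_lift_max.
    - by have := forallP h2 (lift ord_max i); rewrite mxE liftK.
    - have := forallP h6 i; rewrite mxE.
      by rewrite widen_lift_max liftK.
    - have := forallP h4 i; rewrite mxE.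
      have -> : ord0 = lift ord_max (@ord0 n) :> 'I_n.+2
        by rewrite -widen_lift_max; apply/val_inj.
      by rewrite liftK.
  split; first (apply/and4P; split); try (apply/andP; split);
    apply/forallP => i; rewrite mxE.
  - case: unliftP => [k ->|->].
      rewrite (eqP (forallP h1 k)) /top_boundary.
      by rewrite -widen_lift_max.
    apply/eqP/esym/negbTE; apply/existsP => -[j] /eqP /= e.
    by have := hn j; rewrite e ltnn.
  - by case: unliftP => [k _|//]; exact: (forallP h2 k).
  - by rewrite unlift_none.
  - have -> : ord0 = lift ord_max (@ord0 n) :> 'I_n.+2
        by rewrite -widen_lift_max; apply/val_inj.
    by rewrite liftK; exact: (forallP h4 i).
  - by rewrite unlift_none.
  - by rewrite widen_lift_max liftK; exact: (forallP h3 i).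
rewrite /state_weight; apply: eq_bigr => i _.
rewrite big_ord_recr /= (eqP (he i)) !mxE lift0_max !unlift_none /= mulr1.
apply: eq_bigr => k _.
by rewrite !mxE lift0_widen !widen_lift_max !liftK.
Qed.

Lemma ZR_columns (F : fieldType) (m r n d : nat) (q Phi : F)
    (X : 'I_m -> 'I_m -> F) (col : nat -> 'I_m) (mu : 'I_r -> nat)
    (sigma : 'I_r -> 'I_m) (z : 'I_r -> F) (hn : forall i, (mu i < n)%N) :
  partition_function (weightR q Phi X) (fun k : 'I_(d + n) => col k)
    (top_boundary mu) (fun=> false) (fun=> None) (fun i => Some (sigma i)) z =
  partition_function (weightR q Phi X) (fun k : 'I_n => col k)
    (top_boundary mu) (fun=> false) (fun=> None) (fun i => Some (sigma i)) z.
Proof.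
elim: d => [//|d IH]; rewrite -IH; apply: ZR_column => i.
exact: leq_trans (hn i) (leq_addl _ _).
Qed.

Lemma ZR_nat_color (F : fieldType) (m r : nat) (q Phi : F)
    (X : 'I_m -> 'I_m -> F) (N : nat) (mu : 'I_r -> nat)
    (sigma : 'I_r -> 'I_m) (z : 'I_r -> F) (m_gt0 : (0 < m)%N) :
  ZR q Phi X N mu sigma z =
  partition_function (weightR q Phi X)
    (fun k : 'I_(N * m) => rev_ord (Ordinal (ltn_pmod k m_gt0)))
    (top_boundary mu) (fun=> false) (fun=> None) (fun i => Some (sigma i)) z.
Proof.
apply: eq_bigr => s _; apply: eq_bigr => i _; apply: eq_bigr => k _.
by congr (weightR _ _ _ (rev_ord _)); apply/val_inj.
Qed.

Lemma ZR_blocks (F : fieldType) (m r : nat) (q Phi : F)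
    (X : 'I_m -> 'I_m -> F) (N M : nat) (mu : 'I_r -> nat)
    (sigma : 'I_r -> 'I_m) (z : 'I_r -> F) (r_gt0 : (0 < r)%N)
    (hN : forall i, (mu i < N * m)%N) (hM : forall i, (mu i < M * m)%N) :
  ZR q Phi X N mu sigma z = ZR q Phi X M mu sigma z.
Proof.
have m_gt0 : (0 < m)%N.
  exact: leq_ltn_trans (leq0n _) (ltn_ord (sigma (Ordinal r_gt0))).
wlog leNM : N M hN hM / (N <= M)%N.
  by move=> W; case/orP: (leq_total N M) => ?; [|symmetry]; apply: W.
rewrite !(ZR_nat_color _ _ _ _ _ _ _ m_gt0) -(subnK leNM) mulnDl.
have := ZR_columns ((M - N) * m) q Phi X
  (fun k => rev_ord (Ordinal (ltn_pmod k m_gt0))) sigma z hN.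
by move=> ->.
Qed.

(* Main.v *)
(** Row by row, both partition functions are products of transfer matrices on
    the states of the vertical edges. A right-moving row whose bottom edges are
    all empty equals z^N times the left-moving row with the same top edges. A
    right-moving row commutes with a left-moving row: a crossing of the two
    horizontal lines is pushed through the grid by a mixed Yang-Baxter equation,
    and the boundary conditions force it to contribute the same scalar at both
    ends. So the last row of the right-moving system can be made left-moving and
    moved up to the top; repeating this reverses the order of the rows.

    The scalar may vanish at special parameters. It does not vanish for a
    polynomial deformation of the parameters, so commutation is proved over
    F[t] and then specialized at t = 0. *)

Require Import Defs.
From mathcomp Require Import all_boot all_order all_algebra ring zify.

Set Implicit Arguments.
Unset Strict Implicit.
Unset Printing Implicit Defensive.

Import GRing.Theory.

Local Open Scope ring_scope.

(** * Vertex weights over a commutative ring *)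

(* The weights of Defs over an arbitrary commutative ring, so that they can be
   specialized along ring morphisms. *)
Section Weights.
Variables (R : comNzRingType) (m : nat).
Implicit Types (q Phi z w : R) (X : 'I_m -> 'I_m -> R) (j : 'I_m).

Definition rweight q Phi X j z (t : bool) (l : option 'I_m) (b : bool)
    (rt : option 'I_m) : R :=
  match t, l, b, rt with
  | false, None, false, None => 1
  | true, Some i, true, Some i' =>
      if i == i' then Phi * X i j * (if i == j then z else 1) else 0
  | true, None, true, None => Phi
  | false, Some i, false, Some i' =>
      if i == i' then (if i == j then z else 1) else 0
  | false, Some i, true, None =>
      if i == j then Phi * (1 - q ^+ 2) * z else 0
  | true, None, false, Some i => if i == j then 1 else 0
  | _, _, _, _ => 0
  end.

(* [w] stands for the inverse of the row parameter. *)
Definition lweight q Phi X j w (t : bool) (l : option 'I_m) (b : bool)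
    (rt : option 'I_m) : R :=
  match t, l, b, rt with
  | false, None, false, None => 1
  | true, Some i', true, Some i =>
      if i == i' then Phi * X j i * (if i == j then w else 1) else 0
  | true, None, true, None => Phi
  | false, Some i', false, Some i =>
      if i == i' then (if i == j then w else 1) else 0
  | false, None, true, Some i =>
      if i == j then Phi * (1 - q ^+ 2) else 0
  | true, Some i, false, None => if i == j then w else 0
  | _, _, _, _ => 0
  end.

Lemma sum_supp1 (I : finType) (i0 : I) (f g : I -> R) :
  (forall i, i != i0 -> g i = 0) -> \sum_i f i * g i = f i0 * g i0.
Proof.
move=> g0; rewrite (bigD1 i0) //= big1 ?addr0 // => i /g0 ->.
by rewrite mulr0.
Qed.

Lemma sum_supp0 (I : finType) (f g : I -> R) :
  (forall i, g i = 0) -> \sum_i f i * g i = 0.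
Proof. by move=> g0; rewrite big1 // => i _; rewrite g0 mulr0. Qed.

Variables (q Phi : R) (X : 'I_m -> 'I_m -> R) (j : 'I_m) (z w : R).
Local Notation wR := (rweight q Phi X j z).
Local Notation wL := (lweight q Phi X j w).

(** Paths are neither created, destroyed nor recolored at a vertex, so at most one label [c] gives a
    nonzero term. [f] is arbitrary so that crossing weights can be substituted for it. *)
Lemma sum_rweight_left (f : option 'I_m -> R) t v r :
  \sum_c f c * wR t c v r =
  match t, v, r with
  | false, true, None => f (Some j) * (Phi * (1 - q ^+ 2) * z)
  | false, true, Some _ => 0
  | true, false, Some i => if i == j then f None else 0
  | true, false, None => 0
  | _, _, _ => f r * wR t r v r
  end.
Proof.
case: t; case: v; case: r => [r|].
- by apply: sum_supp1 => -[i|//] /= /negPf; rewrite (inj_eq Some_inj) => ->.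
- by apply: sum_supp1 => -[].
- rewrite (sum_supp1 (i0 := None)) => [|[]//].
  by rewrite /=; case: ifP; rewrite ?mulr1 ?mulr0.
- by apply: sum_supp0 => -[].
- by apply: sum_supp0 => -[].
- rewrite (sum_supp1 (i0 := Some j)) /= ?eqxx // => -[i|//] /=.
  by rewrite (inj_eq Some_inj) => /negPf ->.
- by apply: sum_supp1 => -[i|//] /= /negPf; rewrite (inj_eq Some_inj) => ->.
- by apply: sum_supp1 => -[].
Qed.

Lemma sum_lweight_left (f : option 'I_m -> R) t v r :
  \sum_c f c * wL t c v r =
  match t, v, r with
  | false, true, None => 0
  | false, true, Some i => if i == j then f None * (Phi * (1 - q ^+ 2)) else 0
  | true, false, Some i => 0
  | true, false, None => f (Some j) * w
  | _, _, _ => f r * wL t r v r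
  end.
Proof.
case: t; case: v; case: r => [r|].
- by apply: sum_supp1 => -[i|//] /= /negPf;
     rewrite (inj_eq Some_inj) eq_sym => ->.
- by apply: sum_supp1 => -[].
- by apply: sum_supp0 => -[].
- rewrite (sum_supp1 (i0 := Some j)) /= ?eqxx // => -[i|//] /=.
  by rewrite (inj_eq Some_inj) => /negPf ->.
- rewrite (sum_supp1 (i0 := None)) => [|[]//].
  by rewrite /=; case: ifP; rewrite ?mulr1 ?mulr0.
- by apply: sum_supp0 => -[].
- by apply: sum_supp1 => -[i|//] /= /negPf;
     rewrite (inj_eq Some_inj) eq_sym => ->.
- by apply: sum_supp1 => -[].
Qed.

Lemma sum_rweight_right (f : option 'I_m -> R) t v l :
  \sum_c f c * wR t l v c =
  match t, v, l with
  | false, true, None => 0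
  | false, true, Some i =>
      if i == j then f None * (Phi * (1 - q ^+ 2) * z) else 0
  | true, false, Some i => 0
  | true, false, None => f (Some j)
  | _, _, _ => f l * wR t l v l
  end.
Proof.
case: t; case: v; case: l => [l|].
- by apply: sum_supp1 => -[i|//] /= /negPf;
     rewrite (inj_eq Some_inj) eq_sym => ->.
- by apply: sum_supp1 => -[].
- by apply: sum_supp0 => -[].
- rewrite (sum_supp1 (i0 := Some j)) /= ?eqxx ?mulr1 // => -[i|//] /=.
  by rewrite (inj_eq Some_inj) => /negPf ->.
- rewrite (sum_supp1 (i0 := None)) => [|[]//].
  by rewrite /=; case: ifP; rewrite ?mulr1 ?mulr0.
- by apply: sum_supp0 => -[].
- by apply: sum_supp1 => -[i|//] /= /negPf;
     rewrite (inj_eq Some_inj) eq_sym => ->.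
- by apply: sum_supp1 => -[].
Qed.

Lemma sum_lweight_right (f : option 'I_m -> R) t v l :
  \sum_c f c * wL t l v c =
  match t, v, l with
  | false, true, None => f (Some j) * (Phi * (1 - q ^+ 2))
  | false, true, Some _ => 0
  | true, false, Some i => if i == j then f None * w else 0
  | true, false, None => 0
  | _, _, _ => f l * wL t l v l
  end.
Proof.
case: t; case: v; case: l => [l|].
- by apply: sum_supp1 => -[i|//] /= /negPf; rewrite (inj_eq Some_inj) => ->.
- by apply: sum_supp1 => -[].
- rewrite (sum_supp1 (i0 := None)) => [|[]//].
  by rewrite /=; case: ifP; rewrite ?mulr1 ?mulr0.
- by apply: sum_supp0 => -[].
- by apply: sum_supp0 => -[].
- rewrite (sum_supp1 (i0 := Some j)) /= ?eqxx // => -[i|//] /=.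
  by rewrite (inj_eq Some_inj) => /negPf ->.
- by apply: sum_supp1 => -[i|//] /= /negPf; rewrite (inj_eq Some_inj) => ->.
- by apply: sum_supp1 => -[].
Qed.

End Weights.

(** * Mixed Yang-Baxter equation for one column *)

(* Crossing of the right-moving line (labels [aR] left, [bR] right) with the
   left-moving one (labels [aL] left, [bL] right), with denominators cleared.
   The standing relations are [u = z / z'] for the two row parameters and
   [Q = q ^ (2 (m - 1))]; [al], [be] and [ga] depend on the position of the
   crossing, see [crossing_at]. *)
Definition crossing (R : comNzRingType) m (q Phi Q u : R)
    (X : 'I_m -> 'I_m -> R) (al be : 'I_m -> R) (ga : 'I_m -> 'I_m -> R)
    (aR aL bR bL : option 'I_m) : R :=
  match aR, aL, bR, bL with
  | None, None, None, None => Phi ^+ 2 * q ^+ 2 * (1 - q ^+ 4 * Q * u)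
  | None, None, Some i, Some k =>
      if i == k then Phi * q ^+ 2 * (1 - q ^+ 2) * be i else 0
  | None, Some i, None, Some k =>
      if i == k then Phi * q ^+ 2 * (1 - q ^+ 2 * Q * u) else 0
  | Some i, None, Some k, None =>
      if i == k then Phi * q ^+ 2 * (1 - q ^+ 2 * Q * u) else 0
  | Some i, Some k, None, None =>
      if i == k then Phi * q ^+ 2 * (1 - q ^+ 2) * u * al i else 0
  | Some i, Some i', Some k, Some k' =>
      if i == i' then
        if k == k' then
          if i == k then q ^+ 2 * (Q * u - 1)
          else q ^+ 2 * (1 - q ^+ 2) * ga i k
        else 0
      else if (i == k) && (i' == k') then (1 - q ^+ 2 * Q * u) * X i' i else 0
  | _, _, _, _ => 0
  end.

Section YangBaxter.
Variables (R : comNzRingType) (m : nat).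
Variables (q Phi Q z w : R) (X : 'I_m -> 'I_m -> R) (j : 'I_m).
Hypothesis X_diag : forall i, X i i = - q ^+ 2.
Hypothesis X_offdiag : forall i k, i != k -> X i k * X k i = q ^+ 2.
(* Primed data belong to the left of the column of color [j], unprimed data to
   its right. *)
Variables (al be al' be' : 'I_m -> R) (ga ga' : 'I_m -> 'I_m -> R).
Hypotheses (al_j : al j = Q) (be_j : be j = 1) (al'_j : al' j = 1)
  (be'_j : be' j = Q).
Hypotheses (al'E : forall i, i != j -> al' i = q ^+ 2 * al i)
  (beE : forall i, i != j -> be i = q ^+ 2 * be' i).
Hypotheses
  (gaE : forall i k, i != k -> i != j -> k != j -> ga' i k = ga i k)
  (ga_j : forall i, i != j -> ga i j = z * w * al i)
  (ga_j' : forall i, i != j -> ga j i = be' i)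
  (ga'_j : forall i, i != j -> ga' i j = al i)
  (ga'_j' : forall i, i != j -> ga' j i = z * w * be' i).

Local Notation wR := (rweight q Phi X j z).
Local Notation wL := (lweight q Phi X j w).
Local Notation A := (crossing q Phi Q (z * w) X al be ga).
Local Notation A' := (crossing q Phi Q (z * w) X al' be' ga').

(** Only entries of [crossing] where a path turns back from one line to the other involve [al], [be]
    and [ga]. The hypotheses on these say how they change across a column of color [j]; with this
    change the two sides agree in every case. *)
Lemma yang_baxter t b aR aL bR bL :
  \sum_cR \sum_cL A' aR aL cR cL *
    (\sum_v wR t cR v bR * wL v cL b bL) =
  \sum_cR \sum_cL (\sum_v wL t aL v cL * wR v aR b cR) * A cR cL bR bL.
Proof.
(* Both sides are regrouped so that each horizontal label is summed against a single vertex weight,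
   the form of the four summation lemmas. *)
have -> : \sum_cR \sum_cL A' aR aL cR cL * (\sum_v wR t cR v bR * wL v cL b bL)
  = \sum_v \sum_cR (\sum_cL A' aR aL cR cL * wL v cL b bL) * wR t cR v bR.
  rewrite [RHS]exchange_big; apply: eq_bigr => cR _ /=.
  under eq_bigr => cL _ do rewrite mulr_sumr.
  rewrite exchange_big; apply: eq_bigr => v _ /=; rewrite mulr_suml.
  by apply: eq_bigr => cL _; rewrite -mulrA [wL _ _ _ _ * _]mulrC.
have -> : \sum_cR \sum_cL (\sum_v wL t aL v cL * wR v aR b cR) * A cR cL bR bL
  = \sum_v \sum_cL (\sum_cR A cR cL bR bL * wR v aR b cR) * wL t aL v cL.
  rewrite [LHS]exchange_big [RHS]exchange_big; apply: eq_bigr => cL _ /=.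
  under eq_bigr => cR _ do rewrite mulr_suml.
  rewrite exchange_big; apply: eq_bigr => v _ /=; rewrite mulr_suml.
  by apply: eq_bigr => cR _; ring.
(* By path conservation the sums over horizontal labels have at most one term,
   which leaves a case analysis on the equalities between the colors. *)
rewrite !big_bool !sum_rweight_left !sum_lweight_right.
rewrite !sum_lweight_left !sum_rweight_right.
case: t; case: b; case: aR => [i|]; case: aL => [i'|]; case: bR => [k|];
  case: bL => [k'|].
all: rewrite /= ?mul0r ?addr0 ?mulr0 ?add0r ?if_same ?eqxx //.
all: repeat match goal with |- context[?a == ?b] =>
   let E := fresh "E" in
   case: (eqVneq a b) => [E|E];
   [ match a with j => subst b | _ => subst a end
   | rewrite ?[b == a]eq_sym ?(negPf E)] ; rewrite /= ?eqxx /= end.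
all: rewrite ?al_j ?be_j ?al'_j ?be'_j ?X_diag.
all: try match goal with E : is_true (?i != ?i) |- _ => by case/eqP: E end.
all: try match goal with Hi : is_true (?i != j), Hk : is_true (?k != j)
  |- context [ga' ?i ?k] => rewrite (gaE _ Hi Hk); [|by [|rewrite eq_sym]] end.
all: repeat match goal with
  | E : is_true (?i != j) |- _ =>
    have := X_offdiag E;
    rewrite ?(al'E E) ?(beE E) ?(ga_j E) ?(ga_j' E) ?(ga'_j E) ?(ga'_j' E);
    clear E; move=> ?
 end.
all: try solve [ring].
(* The remaining cases need the value of [X i j * X j i], for one or two colors different from
   [j]. *)
all: try match goal with
  | H : X ?i j * X j ?i = _, H' : X ?k j * X j ?k = _ |- _ => ring: H H'
  | H : X ?i j * X j ?i = _ |- _ => ring: H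
  end.
Qed.
End YangBaxter.

(** * Products of transfer matrices as sums over sequences of states *)

Definition fcons (T : Type) n (x : T) (g : {ffun 'I_n -> T}) :
  {ffun 'I_n.+1 -> T} := [ffun k => oapp g x (unlift ord0 k)].

Lemma fcons0 (T : Type) n (x : T) (g : {ffun 'I_n -> T}) : fcons x g ord0 = x.
Proof. by rewrite ffunE unlift_none. Qed.

Lemma fconsS (T : Type) n (x : T) (g : {ffun 'I_n -> T}) k :
  fcons x g (lift ord0 k) = g k.
Proof. by rewrite ffunE liftK. Qed.

Lemma big_fcons (R : nmodType) (T : finType) n
    (F : {ffun 'I_n.+1 -> T} -> R) :
  \sum_f F f = \sum_x \sum_g F (fcons x g).
Proof.
rewrite pair_bigA /=.
rewrite (reindex (fun p : T * {ffun 'I_n -> T} => fcons p.1 p.2)) //=.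
exists (fun f => (f ord0, [ffun k => f (lift ord0 k)])).
  case=> x g _; rewrite fcons0; congr (_, _); apply/ffunP => k.
  by rewrite ffunE fconsS.
move=> f _; apply/ffunP => k; case: (unliftP ord0 k) => [k' ->|->].
  by rewrite fconsS ffunE.
by rewrite fcons0.
Qed.

Lemma big_ffun0 (R : nmodType) (T : finType) (F : {ffun 'I_0 -> T} -> R) f :
  \sum_g F g = F f.
Proof.
by rewrite (big_pred1 f) // => g; apply/esym/eqP/ffunP => -[].
Qed.

Section Chain.
Variables (R : comNzRingType) (W : finType).

(* Matrix product of the transfer matrices [T 0, ..., T (n - 1)]. *)
Fixpoint chain n : ('I_n -> W -> W -> R) -> W -> W -> R :=
  match n with
  | 0 => fun _ x y => (x == y)%:R
  | n'.+1 => fun T x y =>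
      \sum_c T ord0 x c * chain (fun k => T (lift ord0 k)) c y
  end.

Lemma eq_chain n (T T' : 'I_n -> W -> W -> R) :
  (forall k x y, T k x y = T' k x y) ->
  forall x y, chain T x y = chain T' x y.
Proof.
elim: n T T' => [//|n IH] T T' eqT x y /=.
by apply: eq_bigr => c _; rewrite eqT; congr (_ * _); apply: IH.
Qed.

(** The induction groups the sequences [h] by the state that follows the first factor. *)
Lemma chainE n (T : 'I_n -> W -> W -> R) x y :
  chain T x y =
  \sum_(h : {ffun 'I_n.+1 -> W} | (h ord0 == x) && (h ord_max == y))
    \prod_(k < n) T k (h (widen_ord (leqnSn n) k)) (h (lift ord0 k)).
Proof.
elim: n T x y => [|n IH] T x y.
  rewrite big_mkcond big_fcons /= (bigD1 x) //=.
  rewrite [X in _ + X]big1 ?addr0 => [|z nz].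
    rewrite (big_ffun0 _ [ffun=> x]) !fcons0 big_ord0.
    have -> : ord_max = ord0 :> 'I_1 by apply/val_inj.
    by rewrite fcons0 eqxx; case: eqP.
  by rewrite big1 // => g _; rewrite fcons0 (negPf nz).
have prodE c (g : {ffun 'I_n.+1 -> W}) :
  \prod_(k < n.+1) T k (fcons c g (widen_ord (leqnSn n.+1) k))
                       (fcons c g (lift ord0 k)) =
  T ord0 c (g ord0) * \prod_(k < n)
     T (lift ord0 k) (g (widen_ord (leqnSn n) k)) (g (lift ord0 k)).
  rewrite big_ord_recl fconsS; congr (T _ _ _ * _).
    by rewrite -[RHS](fcons0 c g); congr (fcons c g _); apply/val_inj.
  apply: eq_bigr => k _; rewrite fconsS; congr (T _ _ _).
  by rewrite -[RHS](fconsS c g); congr (fcons c g _); apply/val_inj.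
rewrite big_mkcond big_fcons /= [RHS](bigD1 x) //= [X in _ = _ + X]big1 ?addr0.
  under [RHS]eq_bigr => g _ do
    rewrite fcons0 eqxx /= -lift0_max fconsS prodE.
  rewrite -big_mkcond /=.
  rewrite (partition_big (fun g : {ffun 'I_n.+1 -> W} => g ord0) xpredT) //=.
  apply: eq_bigr => c _; rewrite IH mulr_sumr.
  by apply: eq_big => g; rewrite andbC // => /andP[_ /eqP ->].
by move=> z nz; rewrite big1 // => g _; rewrite fcons0 (negPf nz).
Qed.

End Chain.

(** * Partition functions as products of row transfer matrices *)

Section PartitionFunction.
Variables (R : comNzRingType) (m : nat).

(** Columns are numbered from right to left, so the chain runs from the right boundary label [r] to
    the left one [l]. *)
Definition row_weight (wt : 'I_m -> bool -> option 'I_m -> bool ->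
    option 'I_m -> R) n (col : 'I_n -> 'I_m) (t b : 'I_n -> bool)
    (l r : option 'I_m) : R :=
  chain (fun k x y => wt (col k) (t k) y (b k) x) r l.

End PartitionFunction.

Lemma big_matrix_ffun (R : nmodType) (T : finType) r n (F : 'M[T]_(r, n) -> R) :
  \sum_M F M =
  \sum_(f : {ffun 'I_r -> {ffun 'I_n -> T}}) F (\matrix_(i, k) f i k).
Proof.
rewrite (reindex (fun f : {ffun 'I_r -> {ffun 'I_n -> T}} =>
  \matrix_(i, k) f i k)) //.
exists (fun M : 'M[T]_(r, n) => [ffun i => [ffun k => M i k]]) => [f|M] _.
  by apply/ffunP => i; apply/ffunP => k; rewrite !ffunE mxE.
by apply/matrixP => i k; rewrite !mxE !ffunE.
Qed.

(** Two nested chains: the outer one multiplies the rows and sums over vertical edges, the inner one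
    sums over the horizontal labels of one row. *)
Lemma partition_functionE (F : fieldType) (m r n : nat)
    (wt : 'I_m -> F -> bool -> option 'I_m -> bool -> option 'I_m -> F)
    (col : 'I_n -> 'I_m) (top bottom : 'I_n -> bool)
    (left right : 'I_r -> option 'I_m) (z : 'I_r -> F) :
  partition_function wt col top bottom left right z =
  chain (fun i (t b : {ffun 'I_n -> bool}) =>
           row_weight (fun j => wt j (z i)) col t b (left i) (right i))
    [ffun k => top k] [ffun k => bottom k].
Proof.
rewrite chainE /partition_function big_mkcond.
rewrite -(pair_bigA _ (fun V H => if has_boundary top bottom left right (V, H)
  then state_weight wt col z (V, H) else 0)) /=.
rewrite big_matrix_ffun [RHS]big_mkcond; apply: eq_bigr => V _.
rewrite big_matrix_ffun.
pose P i (h : {ffun 'I_n.+1 -> option 'I_m}) :=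
  (h ord0 == right i) && (h ord_max == left i).
have boundaryE (H : {ffun 'I_r -> {ffun 'I_n.+1 -> option 'I_m}}) :
    has_boundary top bottom left right
      (\matrix_(i, k) V i k, \matrix_(i, k) H i k) =
    (V ord0 == [ffun k => top k]) && (V ord_max == [ffun k => bottom k])
      && [forall i, P i (H i)].
  rewrite /has_boundary /= -andbA; congr [&& _, _ & _].
  - apply/forallP/eqP => [h|h k]; last by rewrite mxE h ffunE.
    by apply/ffunP => k; rewrite ffunE -(eqP (h k)) mxE.
  - apply/forallP/eqP => [h|h k]; last by rewrite mxE h ffunE.
    by apply/ffunP => k; rewrite ffunE -(eqP (h k)) mxE.
  apply/andP/forallP => [[/forallP hl /forallP hr] i|h].
    by have := hl i; have := hr i; rewrite !mxE /P => -> ->.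
  by split; apply/forallP => i; rewrite mxE; case/andP: (h i).
rewrite (eq_bigr (fun H : {ffun 'I_r -> {ffun 'I_n.+1 -> option 'I_m}} =>
  if (V ord0 == [ffun k => top k]) && (V ord_max == [ffun k => bottom k])
      && [forall i, P i (H i)]
  then state_weight wt col z (\matrix_(i, k) V i k, \matrix_(i, k) H i k)
  else 0)) => [|H _]; last by congr (if _ then _ else _); apply: boundaryE.
case: (_ && _) => /=; last by rewrite big1.
under [RHS]eq_bigr => i _ do rewrite /row_weight chainE big_mkcond.
(* The product over rows of sums over horizontal labels becomes one sum over the horizontal
   labelings of the grid. *)
rewrite bigA_distr_bigA /=; apply: eq_bigr => H _.
case: ifPn => [/forallP hP|/forallPn[i /negPf hP]].
  rewrite /state_weight; apply: eq_bigr => i _.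
  by rewrite -/(P i (H i)) hP; apply: eq_bigr => k _; rewrite !mxE.
by rewrite (bigD1 i) //= -/(P i (H i)) hP mul0r.
Qed.

Lemma sum2_delta (R : comNzRingType) (I J : finType) (f : I -> J -> R) x y :
  \sum_i \sum_j f i j * ((i == x) && (j == y))%:R = f x y.
Proof.
rewrite (bigD1 x) //= (bigD1 y) //= !eqxx mulr1.
rewrite big1 => [|j /negPf ->]; last by rewrite andbF mulr0.
rewrite addr0 big1 ?addr0 // => i /negPf ->.
by rewrite big1 // => j _; rewrite mulr0.
Qed.

(** * Pairs of adjacent rows *)

Section TwoRows.
Variables (R : comNzRingType) (m : nat).
Variables wt1 wt2 : 'I_m -> bool -> option 'I_m -> bool -> option 'I_m -> R.

Lemma eq_row_weight
    (wt : 'I_m -> bool -> option 'I_m -> bool -> option 'I_m -> R)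
    n (col : 'I_n -> 'I_m) (t b t' b' : 'I_n -> bool) l r :
  t =1 t' -> b =1 b' -> row_weight wt col t b l r = row_weight wt col t' b' l r.
Proof. by move=> et eb; apply: eq_chain => k x y; rewrite et eb. Qed.

Lemma row_weightS
    (wt : 'I_m -> bool -> option 'I_m -> bool -> option 'I_m -> R)
    n (col : 'I_n.+1 -> 'I_m) (t b : 'I_n.+1 -> bool) l r :
  row_weight wt col t b l r =
  \sum_c wt (col ord0) (t ord0) c (b ord0) r *
    row_weight wt (col \o lift ord0) (t \o lift ord0) (b \o lift ord0) l c.
Proof. by []. Qed.

(** [wt1] is the upper row and [v] the state of the vertical edges between the rows. *)
Definition two_rows n (col : 'I_n -> 'I_m) (t b : 'I_n -> bool)
    (l1 l2 r1 r2 : option 'I_m) : R :=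
  \sum_(v : {ffun 'I_n -> bool})
    row_weight wt1 col t v l1 r1 * row_weight wt2 col v b l2 r2.

Lemma two_rows0 (col : 'I_0 -> 'I_m) t b l1 l2 r1 r2 :
  two_rows col t b l1 l2 r1 r2 = ((r1 == l1) && (r2 == l2))%:R.
Proof.
by rewrite /two_rows (big_ffun0 _ [ffun=> true]) /= -natrM mulnb.
Qed.

(** Column 0 is the rightmost one, and [c], [d] are the labels on its left. The sum over its middle
    edge has the form met in [yang_baxter]. *)
Lemma two_rowsS n (col : 'I_n.+1 -> 'I_m) t b l1 l2 r1 r2 :
  two_rows col t b l1 l2 r1 r2 =
  \sum_c \sum_d
    two_rows (col \o lift ord0) (t \o lift ord0) (b \o lift ord0) l1 l2 c d *
    (\sum_v wt1 (col ord0) (t ord0) c v r1 * wt2 (col ord0) v d (b ord0) r2).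
Proof.
pose g1 c (v : {ffun 'I_n -> bool}) :=
  row_weight wt1 (col \o lift ord0) (t \o lift ord0) v l1 c.
pose g2 d (v : {ffun 'I_n -> bool}) :=
  row_weight wt2 (col \o lift ord0) v (b \o lift ord0) l2 d.
transitivity (\sum_x \sum_(v : {ffun 'I_n -> bool}) \sum_c \sum_d
  (wt1 (col ord0) (t ord0) c x r1 * g1 c v) *
  (wt2 (col ord0) x d (b ord0) r2 * g2 d v)).
  rewrite /two_rows big_fcons; apply: eq_bigr => x _; apply: eq_bigr => v _.
  rewrite !row_weightS fcons0 mulr_suml; apply: eq_bigr => c _.
  rewrite mulr_sumr; apply: eq_bigr => d _.
  by congr (_ * _ * (_ * _)); apply: eq_row_weight => k //=; rewrite fconsS.
under eq_bigr do rewrite exchange_big /=.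
rewrite exchange_big /=; apply: eq_bigr => c _.
under eq_bigr do rewrite exchange_big /=.
rewrite exchange_big /=; apply: eq_bigr => d _.
rewrite exchange_big /= mulr_suml; apply: eq_bigr => v _.
by rewrite mulr_sumr; apply: eq_bigr => x _; rewrite mulrACA mulrC.
Qed.

End TwoRows.

(** * Train argument *)

Section Train.
Variables (R : comNzRingType) (m : nat).
Variables (q Phi z w : R) (X : 'I_m -> 'I_m -> R).
Hypothesis X_diag : forall i, X i i = - q ^+ 2.
Hypothesis X_offdiag : forall i k, i != k -> X i k * X k i = q ^+ 2.

(* [p] is the number of columns to the right of the crossing. [(p + c) %% m]
   counts the columns strictly between the crossing and the nearest column of
   color [c] to its right, the lattice being extended periodically. *)
Definition crossing_at p : option 'I_m -> option 'I_m -> option 'I_m ->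
    option 'I_m -> R :=
  let e (c : 'I_m) := ((p + c) %% m)%N in
  crossing q Phi ((q ^+ 2) ^+ m.-1) (z * w) X
    (fun c => (q ^+ 2) ^+ e c) (fun c => (q ^+ 2) ^+ (m.-1 - e c))
    (fun i k => if (e i < e k)%N then z * w * (q ^+ 2) ^+ (m.-1 - (e k - e i))
                else (q ^+ 2) ^+ (e i - e k).-1).

Local Notation wR := (fun j => rweight q Phi X j z).
Local Notation wL := (fun j => lweight q Phi X j w).

(** [hj] says that column [p] has color [j]. Seen from the left of this column instead of its right,
    the distance to color [j] drops from [m - 1] to 0, and that to any other color grows by 1
    without wrapping around. *)
Lemma yang_baxter_at p (j : 'I_m) (hj : (j + p %% m).+1 = m) t b aR aL bR bL :
  \sum_cR \sum_cL crossing_at p.+1 aR aL cR cL *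
    (\sum_v wR j t cR v bR * wL j v cL b bL) =
  \sum_cR \sum_cL (\sum_v wL j t aL v cL * wR j v aR b cR) *
    crossing_at p cR cL bR bL.
Proof.
have m_gt0 : (0 < m)%N by rewrite -hj.
have ej : ((p + j) %% m)%N = m.-1.
  rewrite {1}(divn_eq p m) -addnA modnMDl addnC modn_small; lia.
have ne i : i != j -> ((p + i) %% m < m.-1)%N.
  move=> nij; rewrite ltn_neqAle -ltnS prednK // ltn_pmod // andbT.
  apply: contraNneq nij => ei; apply/eqP/val_inj; apply/eqP.
  have : (p + i == p + j %[mod m])%N by rewrite ei ej.
  by rewrite eqn_modDl !modn_small.
have e'j : ((p.+1 + j) %% m)%N = 0%N.
  by rewrite addSn -addn1 -modnDml ej addn1 prednK ?modnn.
have e' i : i != j -> ((p.+1 + i) %% m)%N = ((p + i) %% m).+1.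
  move=> /ne hi; rewrite addSn -addn1 -modnDml addn1 modn_small //.
  by rewrite -ltnS prednK in hi.
apply: yang_baxter => //=; rewrite ?ej ?e'j ?subnn ?subn0 //.
- by move=> i /e' ->; rewrite exprS.
- by move=> i /[dup] /ne ? /e' ->; rewrite -exprS; congr (_ ^+ _); lia.
- by move=> i k _ /e' -> /e' ->; rewrite ltnS subSS.
- by move=> i /ne ?; rewrite ifT //; congr (_ * _ ^+ _); lia.
- by move=> i /[dup] /ne ? /e' ->; rewrite ifF; [congr (_ ^+ _) |]; lia.
- by move=> i /e' ->; rewrite subn0.
- by move=> i /[dup] /ne ? /e' ->; rewrite subn0.
Qed.

(** The crossing is pushed from left to right through columns [p + n - 1], ..., [p]. The induction
    hypothesis at [p + 1] takes it through all but the rightmost one, [yang_baxter_at] through that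
    one. *)
Lemma train n p (col : 'I_n -> 'I_m)
    (hcol : forall k : 'I_n, (col k + (p + k) %% m).+1 = m) t b aR aL bR bL :
  \sum_cR \sum_cL crossing_at (p + n) aR aL cR cL *
    two_rows wR wL col t b cR cL bR bL =
  \sum_cR \sum_cL two_rows wL wR col t b aL aR cL cR *
    crossing_at p cR cL bR bL.
Proof.
elim: n p col hcol t b aR aL bR bL => [|n IH] p col hcol t b aR aL bR bL.
  rewrite addn0.
  under eq_bigr => cR _ do under eq_bigr => cL _ do
    rewrite two_rows0 eq_sym [bL == _]eq_sym.
  under [RHS]eq_bigr => cR _ do under eq_bigr => cL _ do
    rewrite two_rows0 andbC mulrC.
  by rewrite !sum2_delta.
pose col' := col \o lift ord0.
pose t' := t \o lift ord0; pose b' := b \o lift ord0.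
have hcol' k : (col' k + (p.+1 + k) %% m).+1 = m.
  by have := hcol (lift ord0 k); rewrite /= -addSnnS.
have h0 : (col ord0 + p %% m).+1 = m.
  by have := hcol ord0; rewrite addn0.
pose RL1 cR cL := \sum_v wR (col ord0) (t ord0) cR v bR *
  wL (col ord0) v cL (b ord0) bL.
pose LR1 eR eL cR cL := \sum_v wL (col ord0) (t ord0) eL v cL *
  wR (col ord0) v eR (b ord0) cR.
transitivity (\sum_cR \sum_cL (\sum_dR \sum_dL
   crossing_at (p + n.+1) aR aL dR dL *
   two_rows wR wL col' t' b' dR dL cR cL) * RL1 cR cL).
  under eq_bigr => dR _.
    under eq_bigr => dL _ do rewrite two_rowsS mulr_sumr.
    rewrite exchange_big /=.
    over.
  rewrite exchange_big /=; apply: eq_bigr => cR _.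
  under eq_bigr => dR _.
    under eq_bigr => dL _ do rewrite mulr_sumr.
    rewrite exchange_big /=.
    over.
  rewrite exchange_big /=; apply: eq_bigr => cL _.
  rewrite mulr_suml; apply: eq_bigr => dR _.
  by rewrite mulr_suml; apply: eq_bigr => dL _; rewrite mulrA.
rewrite -addSnnS.
under eq_bigr => cR _ do under eq_bigr => cL _ do rewrite (IH _ _ hcol').
transitivity (\sum_eR \sum_eL two_rows wL wR col' t' b' aL aR eL eR *
   (\sum_cR \sum_cL crossing_at p.+1 eR eL cR cL * RL1 cR cL)).
  under eq_bigr => cR _.
    under eq_bigr => cL _ do rewrite mulr_suml.
    rewrite exchange_big /=.
    over.
  rewrite exchange_big /=; apply: eq_bigr => eR _.
  under eq_bigr => cR _.
    under eq_bigr => cL _ do rewrite mulr_suml.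
    rewrite exchange_big /=.
    over.
  rewrite exchange_big /=; apply: eq_bigr => eL _.
  rewrite mulr_sumr; apply: eq_bigr => cR _.
  by rewrite mulr_sumr; apply: eq_bigr => cL _; rewrite mulrA.
under eq_bigr => eR _ do under eq_bigr => eL _ do rewrite (yang_baxter_at h0).
under [RHS]eq_bigr => cR _.
  under eq_bigr => cL _.
    rewrite two_rowsS exchange_big mulr_suml /=.
    under eq_bigr => eR _ do rewrite mulr_suml.
    over.
  rewrite exchange_big /=.
  over.
rewrite [RHS]exchange_big /=; apply: eq_bigr => eR _.
under [RHS]eq_bigr => cR _ do rewrite exchange_big /=.
rewrite [RHS]exchange_big /=; apply: eq_bigr => eL _.
rewrite mulr_sumr; apply: eq_bigr => cR _.
by rewrite mulr_sumr; apply: eq_bigr => cL _; rewrite mulrA.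
Qed.

End Train.

(** * Commutation of a right-moving and a left-moving row *)

(** With [None], [Some s2] on the left or [Some s1], [None] on the right, the crossing can only be
    straight. Its weight depends neither on position nor on color, so the same factor appears at
    both ends and [generic] cancels it. *)
Lemma rows_commute_domain (R : idomainType) (m : nat) (q Phi z w : R)
    (X : 'I_m -> 'I_m -> R)
    (X_diag : forall i, X i i = - q ^+ 2)
    (X_offdiag : forall i k, i != k -> X i k * X k i = q ^+ 2)
    (generic : Phi * q ^+ 2 * (1 - q ^+ 2 * (q ^+ 2) ^+ m.-1 * (z * w)) != 0)
    n (col : 'I_n -> 'I_m)
    (hcol : forall k : 'I_n, (col k + k %% m).+1 = m) t b s1 s2 :
  two_rows (fun j => rweight q Phi X j z) (fun j => lweight q Phi X j w)
    col t b None (Some s2) (Some s1) None =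
  two_rows (fun j => lweight q Phi X j w) (fun j => rweight q Phi X j z)
    col t b (Some s2) None None (Some s1).
Proof.
apply: (mulfI generic).
have := @train R m q Phi z w X X_diag X_offdiag n 0 col hcol t b
  None (Some s2) (Some s1) None.
set d := Phi * _ * _.
have crossL cR cL : crossing_at q Phi z w X (0 + n) None (Some s2) cR cL =
    d * ((cR == None) && (cL == Some s2))%:R.
  case: cR cL => [i|] [k|] //=; rewrite ?mulr0 //.
  by rewrite (inj_eq Some_inj) eq_sym; case: eqP; rewrite ?mulr1 ?mulr0.
have crossR cR cL : crossing_at q Phi z w X 0 cR cL (Some s1) None =
    d * ((cR == Some s1) && (cL == None))%:R.
  case: cR cL => [i|] [k|] //=; rewrite ?andbF ?mulr0 //.
  by rewrite (inj_eq Some_inj) andbT; case: eqP; rewrite ?mulr1 ?mulr0.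
under eq_bigr => cR _ do under eq_bigr => cL _ do rewrite crossL mulrAC.
under [RHS]eq_bigr => cR _ do under eq_bigr => cL _ do
  rewrite crossR mulrA [_ * d]mulrC.
by rewrite !sum2_delta.
Qed.

Section Specialization.
Variables (R S : comNzRingType) (f : {rmorphism R -> S}).

Lemma rmorph_chain (W : finType) n (T : 'I_n -> W -> W -> R) x y :
  f (chain T x y) = chain (fun k x y => f (T k x y)) x y.
Proof.
elim: n T x y => [|n IH] T x y /=; first by rewrite rmorph_nat.
by rewrite rmorph_sum; apply: eq_bigr => c _; rewrite rmorphM IH.
Qed.

Variables (m : nat) (q Phi z : R) (X : 'I_m -> 'I_m -> R).

Lemma rmorph_rweight j t l b r :
  f (rweight q Phi X j z t l b r) =
  rweight (f q) (f Phi) (fun i k => f (X i k)) j (f z) t l b r.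
Proof.
case: t l b r => [] [i|] [] [k|] //=; rewrite ?rmorph0 ?rmorph1 //;
  case: ifP => _; rewrite ?(rmorph0, rmorph1, rmorphM, rmorphB, rmorphXn) //;
  by case: ifP => _; rewrite ?rmorph1.
Qed.

Lemma rmorph_lweight j t l b r :
  f (lweight q Phi X j z t l b r) =
  lweight (f q) (f Phi) (fun i k => f (X i k)) j (f z) t l b r.
Proof.
case: t l b r => [] [i|] [] [k|] //=; rewrite ?rmorph0 ?rmorph1 //;
  case: ifP => _; rewrite ?(rmorph0, rmorph1, rmorphM, rmorphB, rmorphXn) //;
  by case: ifP => _; rewrite ?rmorph1.
Qed.

Lemma rmorph_two_rows (wt1 wt2 : 'I_m -> bool -> option 'I_m -> bool ->
      option 'I_m -> R)
    (wt1' wt2' : 'I_m -> bool -> option 'I_m -> bool -> option 'I_m -> S)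
    (e1 : forall j t l b r, f (wt1 j t l b r) = wt1' j t l b r)
    (e2 : forall j t l b r, f (wt2 j t l b r) = wt2' j t l b r)
    n (col : 'I_n -> 'I_m) t b l1 l2 r1 r2 :
  f (two_rows wt1 wt2 col t b l1 l2 r1 r2) =
  two_rows wt1' wt2' col t b l1 l2 r1 r2.
Proof.
rewrite rmorph_sum; apply: eq_bigr => v _.
rewrite rmorphM !rmorph_chain.
by congr (_ * _); apply: eq_chain => k x y; rewrite ?e1 ?e2.
Qed.

End Specialization.

(** Makes [q] nonzero while preserving the relations on [X]. A nonzero [q] is kept constant;
    otherwise [q'] is the variable. *)
Lemma deform_parameters (F : fieldType) (m : nat) (q : F)
    (X : 'I_m -> 'I_m -> F)
    (X_diag : forall i, X i i = - q ^+ 2)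
    (X_offdiag : forall i k, i != k -> X i k * X k i = q ^+ 2) :
  exists (q' : {poly F}) (X' : 'I_m -> 'I_m -> {poly F}),
    [/\ q' != 0, q'.[0] = q, forall i k, (X' i k).[0] = X i k,
        forall i, X' i i = - q' ^+ 2
      & forall i k, i != k -> X' i k * X' k i = q' ^+ 2].
Proof.
have [q0|q_neq0] := eqVneq q 0; last first.
  exists q%:P, (fun i k => (X i k)%:P); split=> [||i k|i|i k nik].
  - by rewrite polyC_eq0.
  - by rewrite hornerC.
  - by rewrite hornerC.
  - by rewrite X_diag polyCN rmorphXn.
  - by rewrite -polyCM X_offdiag // rmorphXn.
have XX0 i k : i != k -> (X i k == 0) || (X k i == 0).
  by move=> nik; rewrite -mulf_eq0 X_offdiag // q0 expr0n.
(* One of [X i k] and [X k i] vanishes. If both do, each becomes ['X]; otherwise the vanishing one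
   becomes ['X ^+ 2] divided by the other. *)
pose X' i k : {poly F} :=
  if i == k then - 'X ^+ 2 else if X i k != 0 then (X i k)%:P
  else if X k i == 0 then 'X else (X k i)^-1%:P * 'X ^+ 2.
exists 'X, X'; split=> [||i k|i|i k nik].
- by rewrite polyX_eq0.
- by rewrite hornerX q0.
- rewrite /X'; case: eqVneq => [->|nik].
    by rewrite X_diag q0 hornerN !hornerE expr0n.
  case: (eqVneq (X i k) 0) => [->|_] /=; last by rewrite hornerC.
  by case: ifP => _; rewrite ?hornerM ?hornerXn ?hornerX ?expr0n ?mulr0.
- by rewrite /X' eqxx.
rewrite /X' [k == i]eq_sym (negPf nik).
have := XX0 i k nik.
case: (eqVneq (X i k) 0) => [_|nz] /=; last first.
  by move=> /eqP ->; rewrite eqxx /= ?(negPf nz) mulrA -polyCM divff // mul1r.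
case: (eqVneq (X k i) 0) => [_|nz] _ //=.
by rewrite mulrAC -polyCM mulVf // mul1r.
Qed.

Lemma rows_commute (F : fieldType) (m : nat) (q Phi z w : F)
    (X : 'I_m -> 'I_m -> F)
    (X_diag : forall i, X i i = - q ^+ 2)
    (X_offdiag : forall i k, i != k -> X i k * X k i = q ^+ 2)
    n (col : 'I_n -> 'I_m)
    (hcol : forall k : 'I_n, (col k + k %% m).+1 = m) t b s1 s2 :
  two_rows (fun j => rweight q Phi X j z) (fun j => lweight q Phi X j w)
    col t b None (Some s2) (Some s1) None =
  two_rows (fun j => lweight q Phi X j w) (fun j => rweight q Phi X j z)
    col t b (Some s2) None None (Some s1).
Proof.
have [q' [X' [q'_neq0 q'0 X'0 X'_diag X'_offdiag]]] :=
  deform_parameters X_diag X_offdiag.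
(* The shifts make the scalar nonzero: [Phi'] is 1 at [1 - Phi], and the last factor is 1 at [- z],
   where [z'] vanishes. *)
pose Phi' := Phi%:P + 'X; pose z' := z%:P + 'X; pose w' := w%:P.
have Phi'0 : Phi'.[0] = Phi by rewrite !hornerE.
have z'0 : z'.[0] = z by rewrite !hornerE.
have w'0 : w'.[0] = w by rewrite !hornerE.
have generic :
    Phi' * q' ^+ 2 * (1 - q' ^+ 2 * (q' ^+ 2) ^+ m.-1 * (z' * w')) != 0.
  rewrite !mulf_neq0 ?expf_neq0 //.
    apply/eqP => /(congr1 (horner^~ (1 - Phi))) /eqP.
    by rewrite hornerD hornerC hornerX horner0 addrC subrK oner_eq0.
  apply/eqP => /(congr1 (horner^~ (- z))) /eqP.
  have z'N : z'.[- z] = 0 by rewrite hornerD hornerC hornerX subrr.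
  rewrite hornerD hornerN !hornerM z'N mul0r mulr0 subr0 hornerC horner0.
  by rewrite oner_eq0.
have := congr1 (horner_eval 0)
  (rows_commute_domain X'_diag X'_offdiag generic hcol t b s1 s2).
have eR j t1 l b1 r : horner_eval 0 (rweight q' Phi' X' j z' t1 l b1 r) =
    rweight q Phi X j z t1 l b1 r.
  transitivity (rweight q'.[0] Phi'.[0] (fun i k => (X' i k).[0]) j z'.[0]
    t1 l b1 r).
    exact: rmorph_rweight.
  rewrite q'0 Phi'0 z'0.
  by case: t1 l b1 r => [] [i|] [] [k|] //=; rewrite X'0.
have eL j t1 l b1 r : horner_eval 0 (lweight q' Phi' X' j w' t1 l b1 r) =
    lweight q Phi X j w t1 l b1 r.
  transitivity (lweight q'.[0] Phi'.[0] (fun i k => (X' i k).[0]) j w'.[0]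
    t1 l b1 r).
    exact: rmorph_lweight.
  rewrite q'0 Phi'0 w'0.
  by case: t1 l b1 r => [] [i|] [] [k|] //=; rewrite X'0.
by rewrite (rmorph_two_rows eR eL) (rmorph_two_rows eL eR).
Qed.

(** * Rows with empty bottom edges *)

Section LastRow.
Variables (R : comNzRingType) (m : nat).
Variables (q Phi z w : R) (X : 'I_m -> 'I_m -> R).
Hypothesis zw : z * w = 1.
Local Notation wR := (fun j => rweight q Phi X j z).
Local Notation wL := (fun j => lweight q Phi X j w).

Lemma row_rweight_empty n (col : 'I_n -> 'I_m) t :
  row_weight wR col t (fun=> false) None None = \prod_(k < n) (~~ t k)%:R.
Proof.
elim: n col t => [|n IH] col t; first by rewrite big_ord0.
rewrite row_weightS; under eq_bigr do rewrite mulrC.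
rewrite sum_rweight_left IH big_ord_recl.
by case: (t ord0); rewrite ?mul0r ?mul1r ?mulr1.
Qed.

(** The path entering at the right cannot go down, so it runs straight to the left, excludes any
    path from the top and collects [w] at each column of its color. *)
Lemma row_lweight_through n (col : 'I_n -> 'I_m) t l c :
  row_weight wL col t (fun=> false) l (Some c) =
  (l == Some c)%:R * w ^+ (\sum_(k < n) (col k == c)) *
    \prod_(k < n) (~~ t k)%:R.
Proof.
elim: n col t => [|n IH] col t; first by rewrite !big_ord0 !mulr1 eq_sym.
rewrite row_weightS; under eq_bigr do rewrite mulrC.
rewrite sum_lweight_left !big_ord_recl IH.
case: (t ord0) => /=; first by rewrite mul0r mulr0.
by rewrite eqxx [c == _]eq_sym; case: (col ord0 == c);
   rewrite ?add1n ?exprS; ring.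
Qed.

(** Both rows vanish unless exactly one top edge carries a path, and it has color [c]. The
    right-moving path collects [z] at the columns of color [c] to its right; the left-moving one
    collects [w] at those to its left and at its own column. The quotient is one [z] per column of
    color [c]. *)
Lemma row_rweight_lweight n (col : 'I_n -> 'I_m) t c :
  row_weight wR col t (fun=> false) None (Some c) =
  z ^+ (\sum_(k < n) (col k == c)) *
    row_weight wL col t (fun=> false) (Some c) None.
Proof.
elim: n col t => [|n IH] col t; first by rewrite mulr0.
rewrite !row_weightS; under eq_bigr do rewrite mulrC.
under [X in _ = _ * X]eq_bigr do rewrite mulrC.
rewrite sum_rweight_left sum_lweight_left big_ord_recl.
case: (t ord0) => /=; last first.
  by rewrite eqxx IH [c == _]eq_sym; case: (col ord0 == c);
     rewrite ?add1n ?exprS; ring.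
rewrite row_rweight_empty row_lweight_through (inj_eq Some_inj) eq_sym.
case: eqP => [->|_]; last by rewrite !mul0r mulr0.
by rewrite mul1r mulrAC -exprSr mulrA -exprMn zw expr1n mul1r.
Qed.

End LastRow.

(** Each block of [m] columns contains every color exactly once. *)
Lemma count_column_color (N m : nat) (c : 'I_m) :
  (\sum_(k < N * m) (column_color k == c) = N)%N.
Proof.
have m_gt0 : (0 < m)%N by apply: leq_ltn_trans (ltn_ord c).
transitivity (\sum_(k < N * m) (m - (k %% m).+1 == c))%N.
  by apply: eq_bigr => k _; rewrite -val_eqE.
elim: N => [|N IH]; first by rewrite mul0n big_ord0.
rewrite mulSn big_split_ord /= -[in RHS]add1n; congr (_ + _)%N; last first.
  by rewrite -[RHS]IH; apply: eq_bigr => k _; rewrite modnDl.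
have lt_c := ltn_ord c.
(* Counted from the right of a block, color [c] is at position [rev_ord c]. *)
rewrite (bigD1 (rev_ord c)) //= modn_small; last by rewrite ltn_subrL m_gt0.
rewrite subnSK // subKn ?(ltnW lt_c) // eqxx big1 // => k nk.
rewrite modn_small //; apply/eqP; rewrite eqb0; apply: contra nk => /eqP e.
by apply/eqP/val_inj => /=; rewrite -e; have := ltn_ord k; lia.
Qed.

(** * Reversing the order of the rows *)

Section Rotation.
Variables (F : comNzRingType) (W : finType) (I : Type).

Definition act (T : W -> W -> F) (f : W -> F) x := \sum_v T x v * f v.

Lemma eq_act T f g : f =1 g -> act T f =1 act T g.
Proof. by move=> fg x; apply: eq_bigr => v _; rewrite fg. Qed.

Variables (A B : I -> W -> W -> F) (c : I -> F) (f0 : W -> F).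
Hypothesis comm : forall i j x y,
  \sum_v A i x v * B j v y = \sum_v B j x v * A i v y.
Hypothesis base : forall i x, act (A i) f0 x = c i * act (B i) f0 x.

Local Notation run T f s := (foldr (fun i => act (T i)) f s).

Lemma eq_run (T : I -> W -> W -> F) f g s : f =1 g -> run T f s =1 run T g s.
Proof. by move=> fg; elim: s => [//|i s IH] x /=; apply: eq_act. Qed.

Lemma act_scale T a f x : act T (fun y => a * f y) x = a * act T f x.
Proof. by rewrite /act mulr_sumr; apply: eq_bigr => v _; rewrite mulrCA. Qed.

Lemma run_scale (T : I -> W -> W -> F) a f s x :
  run T (fun y => a * f y) s x = a * run T f s x.
Proof.
elim: s x => [//|i s IH] x /=; rewrite -act_scale.
exact: eq_act.
Qed.

Lemma act_comm i j f x : act (A i) (act (B j) f) x = act (B j) (act (A i) f) x.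
Proof.
have actA (S T : W -> W -> F) :
    act S (act T f) x = \sum_y (\sum_v S x v * T v y) * f y.
  rewrite /act; under eq_bigr do rewrite mulr_sumr.
  rewrite exchange_big /=; apply: eq_bigr => y _; rewrite mulr_suml.
  by apply: eq_bigr => v _; rewrite mulrA.
by rewrite !actA; apply: eq_bigr => y _; rewrite comm.
Qed.

Lemma run_comm j f s x : run A (act (B j) f) s x = act (B j) (run A f s) x.
Proof.
elim: s x => [//|i s IH] x /=; rewrite -act_comm.
exact: eq_act.
Qed.

(** The list runs from top to bottom and acts on [f0] at the bottom. Its last [A i] is replaced by
    [c i] times [B i], which then commutes past the other [A] to the front; the induction hypothesis
    applies to what stands below it. *)
Lemma run_rev s x :
  run A f0 s x = (\prod_(i <- s) c i) * run B f0 (rev s) x.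
Proof.
elim/last_ind: s x => [|s i IH] x; first by rewrite big_nil mul1r.
rewrite foldr_rcons (eq_run _ _ (base i)) run_scale run_comm rev_rcons /=.
by rewrite (eq_act _ IH) act_scale big_rcons /= mulrA [c i * _]mulrC.
Qed.

End Rotation.

Lemma chain_run (F : comNzRingType) (W : finType) r
    (T : 'I_r -> W -> W -> F) x y :
  chain T x y =
  foldr (fun i => act (T i)) (fun v => (v == y)%:R) (enum 'I_r) x.
Proof.
elim: r T x => [|r IH] T x; first by rewrite enum_ord0.
rewrite enum_ordSl /= /act; apply: eq_bigr => v _.
by rewrite IH foldr_map.
Qed.

Lemma rev_enum_ord r : map (@rev_ord r) (enum 'I_r) = rev (enum 'I_r).
Proof.
apply: (inj_map val_inj); rewrite map_rev val_enum_ord -map_comp.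
rewrite (eq_map (g := (fun k => r - k.+1)%N \o val)) // map_comp val_enum_ord.
apply: (@eq_from_nth _ 0%N) => [|k];
  rewrite size_map ?size_rev // size_iota => hk.
by rewrite (nth_map 0%N) ?nth_rev ?size_iota // !nth_iota //; lia.
Qed.

(** * The identity of partition functions *)

Theorem theorem3p10 (F : fieldType) (m r : nat) (q Phi : F)
    (X : 'I_m -> 'I_m -> F)
    (X_diag : forall i, X i i = - q ^+ 2)
    (X_offdiag : forall i j, i != j -> X i j * X j i = q ^+ 2)
    (z : 'I_r -> F) (z_neq0 : forall i, z i != 0)
    (mu : 'I_r -> nat)
    (mu_decreasing : forall i j : 'I_r, (i < j)%N -> (mu j < mu i)%N)
    (N : nat) (hN : forall r_gt0 : (0 < r)%N, (mu (Ordinal r_gt0) <= N * m)%N)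
    (sigma : 'I_r -> 'I_m) :
  ZR q Phi X N mu sigma z =
  (\prod_(i < r) z i) ^+ N * ZL q Phi X N mu (w0 sigma) (w0 z).
Proof.
pose A i (t b : {ffun 'I_(N * m) -> bool}) :=
  row_weight (fun j => rweight q Phi X j (z i)) (@column_color N m) t b
    None (Some (sigma i)).
(* [B i] keeps the parameter and boundary color of row [i]; only its direction changes. *)
pose B i (t b : {ffun 'I_(N * m) -> bool}) :=
  row_weight (fun j => lweight q Phi X j (z i)^-1) (@column_color N m) t b
    (Some (sigma i)) None.
pose empty (v : {ffun 'I_(N * m) -> bool}) : F := (v == [ffun=> false])%:R.
have hcol (k : 'I_(N * m)) : (column_color k + k %% m).+1 = m.
  by rewrite /=; have := ltn_pmod k (block_size_gt0 k); lia.
have comm i j x y : \sum_v A i x v * B j v y = \sum_v B j x v * A i v y.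
  exact: (rows_commute Phi (z i) (z j)^-1 X_diag X_offdiag hcol
    x y (sigma i) (sigma j)).
have act_empty T x : act T empty x = T x [ffun=> false].
  rewrite /act (bigD1 [ffun=> false]) //= /empty eqxx mulr1.
  by rewrite big1 ?addr0 // => v /negPf ->; rewrite mulr0.
have base i x : act (A i) empty x = z i ^+ N * act (B i) empty x.
  (* The exponent [N] is the number of columns of color [sigma i]. *)
  rewrite !act_empty -[in z i ^+ N](count_column_color N (sigma i)).
  have ef : ([ffun=> false] : {ffun 'I_(N * m) -> bool}) =1 (fun=> false).
    by move=> k; rewrite ffunE.
  rewrite /A /B !(eq_row_weight _ _ _ _ (frefl x) ef).
  by apply: row_rweight_lweight; rewrite divff.
transitivity (foldr (fun i => act (A i)) empty (enum 'I_r)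
    [ffun k => top_boundary mu k]).
  by rewrite /ZR partition_functionE chain_run.
rewrite (run_rev comm base) prodrXl big_enum /=; congr (_ * _).
(* The reversed list is the list of rows under [rev_ord], which yields [w0 sigma] and [w0 z]. *)
rewrite -rev_enum_ord foldr_map.
by rewrite /ZL partition_functionE chain_run.
Qed.
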